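(* Let $(X,x)$ be a pointed topological space. Every nonempty open or closed subset of $\pi_1^{qtop}(X,x)$ is a disjoint union of some cosets of $\pi_1^{sg}(X,x)$ and also a disjoint union of some cosets of $\overline{\pi_1^{sg}(X,x)}$, where the closure is taken in $\pi_1^{qtop}(X,x)$.
   Context: All homotopies of paths are relative to end points. $\pi_1^{qtop}(X,x)$ is the group $\pi_1(X,x)$ with the quotient topology induced by the canonical map $q:\Omega(X,x)\to\pi_1(X,x)$, $q(\alpha)=[\alpha]$, where $\Omega(X,x)$ is the space of loops in $X$ based at $x$ with the compact-open topology; it is a quasitopological group (a group with a topology in which inversion and all translations are continuous). For $y\in X$, the small loop group $\pi_1^s(X,y)\le \pi_1(X,y)$ is the subgroup of all classes $[\beta]$ of loops $\beta$ at $y$ such that for every open neighborhood $V$ of $y$, $\beta$ is homotopic to a loop at $y$ lying in $V$. The SG (small generated) subgroup $\pi_1^{sg}(X,x)$ is the (normal) subgroup of $\pi_1(X,x)$ generated by all elements $[\alpha*\beta*\alpha^{-1}]$, where $\alpha$ is a path in $X$ with $\alpha(0)=x$ and $[\beta]\in\pi_1^s(X,\alpha(1))$. *)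

(* Defs.v *)
From HB Require Import structures.
From mathcomp Require Import all_boot all_order all_algebra.
From mathcomp Require Import all_classical all_reals.
From mathcomp Require Import topology normedtype homotopy.
From mathcomp Require Import lra.

Set Implicit Arguments.
Unset Strict Implicit.
Unset Printing Implicit Defensive.

Import Order.TTheory GRing.Theory Num.Theory.
Import numFieldNormedType.Exports.

Local Open Scope classical_set_scope.
Local Open Scope ring_scope.
Local Open Scope quotient_scope.

(* The unit interval is the subtype `[0, 1] of an arbitrary [R : realType],
   bipointed by its end points, so that the library's paths
   [{path unit_itv R from x to y}], with their compact-open topology, apply. *)

Section UnitInterval.
Variable R : realType.

Definition unit_itv : Type := set_type (`[0, 1]%classic : set R).

HB.instance Definition _ := Topological.on unit_itv.

(* [toI] is the retraction of the line onto the interval: this makes it possible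
   to evaluate a path at [2 * t] or [2 * t - 1] without proof arguments. *)
Definition clamp (r : R) : R := Num.max 0 (Num.min 1 r).

Lemma clamp_in r : clamp r \in (`[0, 1]%classic : set R).
Proof.
apply/mem_set; rewrite /= in_itv /= /clamp le_max lexx /=.
by rewrite ge_max ler01 ge_min lexx.
Qed.

Definition toI (r : R) : unit_itv := exist _ (clamp r) (clamp_in r).

Definition ofI (t : unit_itv) : R := set_val t.

Lemma ofI_ge0 t : 0 <= ofI t.
Proof. by have := set_valP t; rewrite /= in_itv /= => /andP[]. Qed.

Lemma ofI_le1 t : ofI t <= 1.
Proof. by have := set_valP t; rewrite /= in_itv /= => /andP[]. Qed.

Lemma ofI_inj : injective ofI.
Proof. exact: val_inj. Qed.

Lemma toIK r : 0 <= r -> r <= 1 -> ofI (toI r) = r.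
Proof.
move=> r0 r1; rewrite /ofI set_valE /= /clamp.
by rewrite (min_idPr r1) (max_idPr r0).
Qed.

Lemma toI_ge1 r : 1 <= r -> ofI (toI r) = 1.
Proof.
move=> r1; rewrite /ofI set_valE /= /clamp.
by rewrite (min_idPl r1) (max_idPr ler01).
Qed.

Lemma toI_le0 r : r <= 0 -> ofI (toI r) = 0.
Proof.
move=> r0; rewrite /ofI set_valE /= /clamp.
by rewrite (min_idPr (le_trans r0 ler01)) (max_idPl r0).
Qed.

Lemma ofIK t : toI (ofI t) = t.
Proof. by apply: ofI_inj; rewrite toIK ?ofI_ge0 ?ofI_le1. Qed.

Lemma toI01_neq : toI 0 != toI 1.
Proof.
apply/eqP => /(congr1 ofI); rewrite !toIK ?ler01 // => /esym/eqP.
by rewrite oner_eq0.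
Qed.

HB.instance Definition _ := isBiPointed.Build unit_itv toI01_neq.

Lemma ofI_zero : ofI zero = 0. Proof. by rewrite toIK. Qed.
Lemma ofI_one : ofI one = 1. Proof. by rewrite toIK. Qed.

Lemma ofI_continuous : continuous ofI.
Proof. exact: initial_continuous. Qed.

Lemma toI_continuous : continuous toI.
Proof.
apply: continuous_comp_initial => r.
change ({for r, continuous clamp}); rewrite /clamp.
apply: (@continuous_max R R (fun=> 0) (fun r => Num.min 1 r)); first exact: cvg_cst.
apply: (@continuous_min R R (fun=> 1) id); first exact: cvg_cst.
exact: cvg_id.
Qed.

End UnitInterval.

Section ContinuityHelpers.
Variable R : realType.

Lemma comp_cts (T U V : topologicalType) (f : T -> U) (g : U -> V) :
  continuous g -> continuous f -> continuous (fun t => g (f t)).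
Proof. by move=> cg cf t; apply: continuous_comp; [exact: cf|exact: cg]. Qed.

Lemma pair_cts (T U V : topologicalType) (f : T -> U) (g : T -> V) :
  continuous f -> continuous g -> continuous (fun t => (f t, g t)).
Proof. by move=> cf cg t; apply: cvg_pair; [exact: cf|exact: cg]. Qed.

Lemma fst_cts (T U : topologicalType) : continuous (@fst T U).
Proof. by move=> t; exact: cvg_fst. Qed.

Lemma snd_cts (T U : topologicalType) : continuous (@snd T U).
Proof. by move=> t; exact: cvg_snd. Qed.

Lemma toI_cts (T : topologicalType) (c : T -> R) :
  continuous c -> continuous (fun t => toI (c t)).
Proof. exact: comp_cts (@toI_continuous R). Qed.

Lemma ofI_cts (T : topologicalType) (c : T -> unit_itv R) :
  continuous c -> continuous (fun t => ofI (c t)).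
Proof. exact: comp_cts (@ofI_continuous R). Qed.

Lemma cst_cts (T U : topologicalType) (a : U) : continuous (fun _ : T => a).
Proof. by move=> t; exact: cvg_cst. Qed.

Lemma id_cts (T : topologicalType) : continuous (fun t : T => t).
Proof. by move=> t; exact: cvg_id. Qed.

Arguments comp_cts {T U V f g}.
Variable T : topologicalType.
Implicit Types c d : T -> R.

Lemma add_cts c d :
  continuous c -> continuous d -> continuous (fun t => c t + d t).
Proof. by move=> cc cd t; apply: cvgD; [exact: cc|exact: cd]. Qed.

Lemma sub_cts c d :
  continuous c -> continuous d -> continuous (fun t => c t - d t).
Proof. by move=> cc cd t; apply: cvgB; [exact: cc|exact: cd]. Qed.

Lemma mul_cts c d :
  continuous c -> continuous d -> continuous (fun t => c t * d t).
Proof. by move=> cc cd t; apply: cvgM; [exact: cc|exact: cd]. Qed.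

Lemma max_cts c d :
  continuous c -> continuous d -> continuous (fun t => Num.max (c t) (d t)).
Proof.
by move=> cc cd t; apply: (@continuous_max R T c d); [exact: cc|exact: cd].
Qed.

Lemma min_cts c d :
  continuous c -> continuous d -> continuous (fun t => Num.min (c t) (d t)).
Proof.
by move=> cc cd t; apply: (@continuous_min R T c d); [exact: cc|exact: cd].
Qed.

End ContinuityHelpers.

Ltac cts := cbv beta; try assumption; lazymatch goal with
  | |- continuous fst => exact: fst_cts
  | |- continuous snd => exact: snd_cts
  | |- continuous (fun t => fst t) => exact: fst_cts
  | |- continuous (fun t => snd t) => exact: snd_cts
  | |- continuous (fun t => t) => exact: id_cts
  | |- continuous (fun _ => ?a) => exact: cst_cts
  | |- continuous (fun t => toI _) => apply: toI_cts; cts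
  | |- continuous (fun t => ofI _) => apply: ofI_cts; cts
  | |- continuous (@ofI _) => exact: ofI_continuous
  | |- continuous (fun t => (_, _)) => apply: pair_cts; cts
  | |- continuous (fun t => Num.max _ _) => apply: max_cts; cts
  | |- continuous (fun t => Num.min _ _) => apply: min_cts; cts
  | |- continuous (fun t => _ - _) => apply: sub_cts; cts
  | |- continuous (fun t => _ + _) => apply: add_cts; cts
  | |- continuous (fun t => _ * _) => apply: mul_cts; cts
  | |- _ => idtac
  end.

Section Paths.
Variables (R : realType) (X : topologicalType).
Local Notation I := (unit_itv R).

Lemma glue_continuous (T : topologicalType) (c : T -> R) (u v : T -> X) :
  continuous c -> continuous u -> continuous v ->
  (forall t, c t = 2^-1 -> u t = v t) ->
  continuous (fun t => if c t <= 2^-1 then u t else v t).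
Proof.
move=> cc cu cv uv t V nV.
have near_w (P : T -> Prop) : nbhs t P ->
    (forall s, P s -> V (if c s <= 2^-1 then u s else v s)) ->
    nbhs t ((fun s => if c s <= 2^-1 then u s else v s) @^-1` V).
  by move=> nP PV; apply: filterS nP.
have [lt|gt|e] := ltgtP (c t) 2^-1.
- have Vu : nbhs t (u @^-1` V) by apply: cu; move: nV; rewrite /= (ltW lt).
  have ct : nbhs t (c @^-1` [set r | r < 2^-1]) by apply: cc; exact: lt_nbhsl.
  by apply: (near_w _ (filterI Vu ct)) => s [Vs /ltW /= ->].
- have Vv : nbhs t (v @^-1` V).
    by apply: cv; move: nV; rewrite /= leNgt gt.
  have ct : nbhs t (c @^-1` [set r | 2^-1 < r]) by apply: cc; exact: lt_nbhsr.
  by apply: (near_w _ (filterI Vv ct)) => s [Vs /=]; rewrite leNgt => ->.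
- have Vu : nbhs t (u @^-1` V) by apply: cu; move: nV; rewrite /= e lexx.
  have Vv : nbhs t (v @^-1` V).
    by apply: cv; move: nV; rewrite /= e lexx (uv _ e).
  by apply: (near_w _ (filterI Vu Vv)) => s [Vus Vvs]; case: ifP.
Qed.

Lemma path_cts (x y : X) (f : {path I from x to y}) : continuous f.
Proof. exact: cts_fun. Qed.
Arguments path_cts {x y} f.

Section Concat.
Variables (x y z : X).
Variables (f : {path I from x to y}) (g : {path I from y to z}).

Definition concat_fun (t : I) : X :=
  if ofI t <= 2^-1 then f (toI (2 * ofI t)) else g (toI (2 * ofI t - 1)).

Lemma concat_fun_continuous : continuous concat_fun.
Proof.
apply: glue_continuous; first by cts.
- by apply: (comp_cts (path_cts f)); cts.
- by apply: (comp_cts (path_cts g)); cts.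
- move=> t ->; rewrite divff ?pnatr_eq0 // subrr.
  by rewrite path_one path_zero.
Qed.

Lemma concat_fun_zero : concat_fun zero = x.
Proof.
rewrite /concat_fun ofI_zero invr_ge0 ler0n mulr0.
exact: path_zero.
Qed.

Lemma concat_fun_one : concat_fun one = z.
Proof.
rewrite /concat_fun ofI_one ifF; last by apply/negbTE; rewrite -ltNge; lra.
by rewrite (_ : 2 * 1 - 1 = 1 :> R); [exact: path_one|lra].
Qed.

Definition concat : {path I from x to z} :=
  mk_path concat_fun_continuous concat_fun_zero concat_fun_one.

End Concat.

Section Reverse.
Variables (x y : X) (f : {path I from x to y}).

Definition reverse_fun (t : I) : X := f (toI (1 - ofI t)).

Lemma reverse_fun_continuous : continuous reverse_fun.
Proof.
by apply: (comp_cts (path_cts f)); cts.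
Qed.

Lemma reverse_fun_zero : reverse_fun zero = y.
Proof. by rewrite /reverse_fun ofI_zero subr0; exact: path_one. Qed.

Lemma reverse_fun_one : reverse_fun one = x.
Proof. by rewrite /reverse_fun ofI_one subrr; exact: path_zero. Qed.

Definition reverse : {path I from y to x} :=
  mk_path reverse_fun_continuous reverse_fun_zero reverse_fun_one.

End Reverse.

Definition path_homotopic (x y : X) (f g : {path I from x to y}) : Prop :=
  exists H : I * I -> X,
    [/\ continuous H,
        forall t, H (t, zero) = f t,
        forall t, H (t, one) = g t,
        forall s, H (zero, s) = x &
        forall s, H (one, s) = y].

Lemma path_homotopic_refl x y (f : {path I from x to y}) : path_homotopic f f.
Proof.
exists (fun p => f p.1); split => //= [|_|_]; rewrite ?path_zero ?path_one //.
by apply: (comp_cts (path_cts f)); cts.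
Qed.

Lemma path_homotopic_sym x y (f g : {path I from x to y}) :
  path_homotopic f g -> path_homotopic g f.
Proof.
move=> [H [cH H0 H1 Hx Hy]].
exists (fun p => H (p.1, toI (1 - ofI p.2))); split => /= [|t|t|//|//].
- by apply: (comp_cts cH); cts.
- by rewrite ofI_zero subr0 -H1.
- by rewrite ofI_one subrr -H0.
Qed.

Lemma path_homotopic_trans x y (f g h : {path I from x to y}) :
  path_homotopic f g -> path_homotopic g h -> path_homotopic f h.
Proof.
move=> [H [cH H0 H1 Hx Hy]] [K [cK K0 K1 Kx Ky]].
exists (fun p => if ofI p.2 <= 2^-1 then H (p.1, toI (2 * ofI p.2))
                 else K (p.1, toI (2 * ofI p.2 - 1))).
split => /= [|t|t|s|s].
- apply: glue_continuous; first by cts.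
  + by apply: (comp_cts cH); cts.
  + by apply: (comp_cts cK); cts.
  + move=> p ->; rewrite divff ?pnatr_eq0 // subrr.
    by rewrite H1 K0.
- by rewrite ofI_zero invr_ge0 ler0n mulr0 H0.
- rewrite ofI_one ifF; last by apply/negbTE; rewrite -ltNge; lra.
  by rewrite (_ : 2 * 1 - 1 = 1 :> R) ?K1 //; lra.
- by case: ifP => _; rewrite ?Hx ?Kx.
- by case: ifP => _; rewrite ?Hy ?Ky.
Qed.

Lemma path_homotopic_concat x y z (f f' : {path I from x to y})
    (g g' : {path I from y to z}) :
  path_homotopic f f' -> path_homotopic g g' ->
  path_homotopic (concat f g) (concat f' g').
Proof.
move=> [H [cH H0 H1 Hx Hy]] [K [cK K0 K1 Kx Ky]].
exists (fun p => if ofI p.1 <= 2^-1 then H (toI (2 * ofI p.1), p.2)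
                 else K (toI (2 * ofI p.1 - 1), p.2)).
split => /= [|t|t|s|s].
- apply: glue_continuous; first by cts.
  + by apply: (comp_cts cH); cts.
  + by apply: (comp_cts cK); cts.
  + move=> p ->; rewrite divff ?pnatr_eq0 // subrr.
    by rewrite Hy Kx.
- by rewrite H0 K0.
- by rewrite H1 K1.
- by rewrite ofI_zero invr_ge0 ler0n mulr0 Hx.
- rewrite ofI_one ifF; last by apply/negbTE; rewrite -ltNge; lra.
  by rewrite (_ : 2 * 1 - 1 = 1 :> R) ?Ky //; lra.
Qed.

Lemma path_homotopic_reverse x y (f g : {path I from x to y}) :
  path_homotopic f g -> path_homotopic (reverse f) (reverse g).
Proof.
move=> [H [cH H0 H1 Hx Hy]].
exists (fun p => H (toI (1 - ofI p.1), p.2)); split => /= [|t|t|s|s].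
- by apply: (comp_cts cH); cts.
- by rewrite H0.
- by rewrite H1.
- by rewrite ofI_zero subr0 Hy.
- by rewrite ofI_one subrr Hx.
Qed.

Lemma path_homotopic_repar x y a b (f : {path I from x to y})
    (p q : {path I from a to b}) (phi psi : I -> R) :
  continuous phi -> continuous psi ->
  phi zero = psi zero -> phi one = psi one ->
  (forall t, p t = f (toI (phi t)) :> X) ->
  (forall t, q t = f (toI (psi t)) :> X) ->
  path_homotopic p q.
Proof.
move=> cphi cpsi e0 e1 pE qE.
exists (fun r => f (toI ((1 - ofI r.2) * phi r.1 + ofI r.2 * psi r.1))).
split => /= [|t|t|s|s].
- apply: (comp_cts (path_cts f)); cts.
  + by apply: (comp_cts cphi); cts.
  + by apply: (comp_cts cpsi); cts.
- by rewrite ofI_zero subr0 mul1r mul0r addr0 pE.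
- by rewrite ofI_one subrr mul1r mul0r add0r qE.
- by rewrite -e0 -mulrDl subrK mul1r -pE path_zero.
- by rewrite -e1 -mulrDl subrK mul1r -pE path_one.
Qed.

Definition cst_path (x : X) : {path I from x to x} :=
  mk_path (@cst_continuous I X x) (erefl x) (erefl x).

Lemma concatA x y z w (f : {path I from x to y}) (g : {path I from y to z})
    (h : {path I from z to w}) :
  path_homotopic (concat f (concat g h)) (concat (concat f g) h).
Proof.
apply: (@path_homotopic_repar _ _ _ _ (concat (concat f g) h) _ _
  (fun t => Num.max (ofI t / 2) (Num.max (ofI t - 4^-1) (2 * ofI t - 1)))
  (fun t => ofI t)).
- by cts.
- by cts.
- rewrite ofI_zero mul0r; apply/max_idPl; rewrite ge_max; apply/andP; split; lra.
- rewrite ofI_one mul1r (_ : 2 * 1 - 1 = 1 :> R); last by lra.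
  rewrite (_ : Num.max (1 - _) _ = 1); last by apply/max_idPr; lra.
  by apply/max_idPr; lra.
- move=> t; have t0 := ofI_ge0 t; have t1 := ofI_le1 t.
  have [h1|h1] := leP (ofI t) 2^-1.
    rewrite (_ : Num.max _ _ = ofI t / 2); last first.
      by apply/max_idPl; rewrite ge_max; apply/andP; split; lra.
    rewrite /concat /= /mk_path /concat_fun h1 toIK; [|lra..].
    rewrite ifT; last by lra.
    rewrite /= /mk_path /concat_fun toIK; [|lra..].
    rewrite ifT; last by lra.
    by congr (f (toI _)); lra.
  have [h2|h2] := leP (ofI t) (3 / 4).
    have e1 : 2 * ofI t - 1 <= ofI t - 4^-1 by lra.
    have e2 : ofI t / 2 <= ofI t - 4^-1 by lra.
    rewrite (max_idPl e1) (max_idPr e2).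
    rewrite /concat /= /mk_path /concat_fun toIK; [|lra..].
    rewrite ifF; last by apply/negbTE; rewrite -ltNge; lra.
    rewrite ifT; last by lra.
    rewrite /= /mk_path /concat_fun !toIK; [|lra..].
    rewrite ifT; last by lra.
    rewrite ifF; last by apply/negbTE; rewrite -ltNge; lra.
    by congr (g (toI _)); lra.
  have e1 : ofI t - 4^-1 <= 2 * ofI t - 1 by lra.
  have e2 : ofI t / 2 <= 2 * ofI t - 1 by lra.
  rewrite (max_idPr e1) (max_idPr e2).
  rewrite /concat /= /mk_path /concat_fun toIK; [|lra..].
  rewrite ifF; last by apply/negbTE; rewrite -ltNge; lra.
  rewrite ifF; last by apply/negbTE; rewrite -ltNge; lra.
  rewrite /= /mk_path /concat_fun toIK; [|lra..].
  by rewrite ifF; last by apply/negbTE; rewrite -ltNge; lra.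
- by move=> t; rewrite ofIK.
Qed.

Lemma concat_cst_l x y (f : {path I from x to y}) :
  path_homotopic (concat (cst_path x) f) f.
Proof.
apply: (@path_homotopic_repar _ _ _ _ f _ _
  (fun t => Num.max 0 (2 * ofI t - 1)) (fun t => ofI t)).
- by cts.
- by cts.
- by rewrite ofI_zero; apply/max_idPl; lra.
- by rewrite ofI_one (max_idPr _); lra.
- move=> t; rewrite /concat /= /mk_path /concat_fun.
  have [h|h] := leP (ofI t) 2^-1.
    by rewrite (max_idPl _); [exact/esym/path_zero|lra].
  by rewrite (max_idPr _) //; lra.
- by move=> t; rewrite ofIK.
Qed.

Lemma concat_cst_r x y (f : {path I from x to y}) :
  path_homotopic (concat f (cst_path y)) f.
Proof.
apply: (@path_homotopic_repar _ _ _ _ f _ _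
  (fun t => Num.min 1 (2 * ofI t)) (fun t => ofI t)).
- by cts.
- by cts.
- by rewrite ofI_zero; rewrite (min_idPr _); lra.
- by rewrite ofI_one (min_idPl _); lra.
- move=> t; rewrite /concat /= /mk_path /concat_fun.
  have [h|h] := leP (ofI t) 2^-1.
    by rewrite (min_idPr _) //; lra.
  by rewrite (min_idPl _); [exact/esym/path_one|lra].
- by move=> t; rewrite ofIK.
Qed.

Lemma concat_reverse_r x y (f : {path I from x to y}) :
  path_homotopic (concat f (reverse f)) (cst_path x).
Proof.
apply: (@path_homotopic_repar _ _ _ _ f _ _
  (fun t => Num.min (2 * ofI t) (2 - 2 * ofI t)) (fun=> 0)).
- by cts.
- by cts.
- by rewrite ofI_zero (min_idPl _); lra.
- by rewrite ofI_one (min_idPr _); lra.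
- move=> t; have t0 := ofI_ge0 t; have t1 := ofI_le1 t.
  rewrite /concat /= /mk_path /concat_fun.
  have [h|h] := leP (ofI t) 2^-1.
    by rewrite (min_idPl _) //; lra.
  rewrite /reverse /= /mk_path /reverse_fun toIK; [|lra..].
  by rewrite (min_idPr _); [congr (f (toI _))|]; lra.
- by move=> t; apply: esym; exact: path_zero.
Qed.

Lemma reverseK x y (f : {path I from x to y}) : reverse (reverse f) = f.
Proof.
apply/path_eqP => t; have t0 := ofI_ge0 t; have t1 := ofI_le1 t.
rewrite /reverse /= /mk_path /reverse_fun /= /mk_path /reverse_fun.
by rewrite toIK ?subKr ?ofIK //; lra.
Qed.

Lemma concat_reverse_l x y (f : {path I from x to y}) :
  path_homotopic (concat (reverse f) f) (cst_path y).
Proof. by rewrite -{2}(reverseK f); exact: concat_reverse_r. Qed.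

End Paths.

(* [pi1 R x] carries the quotient topology induced by [pi1_class] from the
   compact-open topology on loops. *)
Section FundamentalGroup.
Variables (R : realType) (X : topologicalType) (x : X).
Local Notation Omega := {path (unit_itv R) from x to x}.

Definition loop_homotopic : rel Omega := fun f g => `[< path_homotopic f g >].

Lemma loop_homotopic_refl : reflexive loop_homotopic.
Proof. by move=> f; apply/asboolP; exact: path_homotopic_refl. Qed.

Lemma loop_homotopic_sym : symmetric loop_homotopic.
Proof. by move=> f g; apply/asboolP/asboolP; exact: path_homotopic_sym. Qed.

Lemma loop_homotopic_trans : transitive loop_homotopic.
Proof.
move=> g f h /asboolP fg /asboolP gh; apply/asboolP.
exact: path_homotopic_trans fg gh.
Qed.

Canonical loop_homotopic_equiv :=
  EquivRel loop_homotopic loop_homotopic_refl loop_homotopic_sym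
    loop_homotopic_trans.

Definition pi1 : Type := quotient_topology {eq_quot loop_homotopic}.

HB.instance Definition _ := Topological.on pi1.

Definition pi1_class (f : Omega) : pi1 :=
  \pi_(quotient_topology {eq_quot loop_homotopic}) f.

Lemma pi1_classP (f g : Omega) :
  pi1_class f = pi1_class g <-> path_homotopic f g.
Proof.
split=> [/eqmodP/asboolP //|h].
by apply/eqmodP/asboolP.
Qed.

Definition pi1_repr (a : pi1) : Omega :=
  repr (a : quotient_topology {eq_quot loop_homotopic}).

Lemma pi1_reprK : cancel pi1_repr pi1_class.
Proof. by move=> a; exact: reprK. Qed.

Definition pi1_mul (a b : pi1) : pi1 :=
  pi1_class (concat (pi1_repr a) (pi1_repr b)).

Definition pi1_inv (a : pi1) : pi1 := pi1_class (reverse (pi1_repr a)).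

Definition pi1_one : pi1 := pi1_class (cst_path R x).

Lemma pi1_mulE (f g : Omega) :
  pi1_mul (pi1_class f) (pi1_class g) = pi1_class (concat f g).
Proof.
by apply/pi1_classP/path_homotopic_concat; apply/pi1_classP; exact: pi1_reprK.
Qed.

Lemma pi1_invE (f : Omega) : pi1_inv (pi1_class f) = pi1_class (reverse f).
Proof.
by apply/pi1_classP/path_homotopic_reverse; apply/pi1_classP; exact: pi1_reprK.
Qed.

Lemma pi1_mulA : associative pi1_mul.
Proof.
move=> a b c; rewrite -(pi1_reprK a) -(pi1_reprK b) -(pi1_reprK c) !pi1_mulE.
by apply/pi1_classP; exact: concatA.
Qed.

Lemma pi1_mul1g : left_id pi1_one pi1_mul.
Proof.
move=> a; rewrite -(pi1_reprK a) pi1_mulE.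
by apply/pi1_classP; exact: concat_cst_l.
Qed.

Lemma pi1_mulg1 : right_id pi1_one pi1_mul.
Proof.
move=> a; rewrite -(pi1_reprK a) pi1_mulE.
by apply/pi1_classP; exact: concat_cst_r.
Qed.

Lemma pi1_mulVg : left_inverse pi1_one pi1_inv pi1_mul.
Proof.
move=> a; rewrite -(pi1_reprK a) pi1_invE pi1_mulE.
by apply/pi1_classP; exact: concat_reverse_l.
Qed.

Lemma pi1_mulgV : right_inverse pi1_one pi1_inv pi1_mul.
Proof.
move=> a; rewrite -(pi1_reprK a) pi1_invE pi1_mulE.
by apply/pi1_classP; exact: concat_reverse_r.
Qed.

HB.instance Definition _ := isGroup.Build pi1 pi1_mulA pi1_mul1g pi1_mulg1
  pi1_mulVg pi1_mulgV.

End FundamentalGroup.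

Section Subgroups.
Variable G : groupType.
Local Open Scope group_scope.

Definition generated_subgroup (S : set G) : set G :=
  smallest [set H : set G | group_closed (mem H)] S.

Definition left_cosets (H : set G) : set (set G) :=
  [set [set g * h | h in H] | g in [set: G]].

Definition right_cosets (H : set G) : set (set G) :=
  [set [set h * g | h in H] | g in [set: G]].

End Subgroups.

Definition disjoint_union_of (T : Type) (F : set (set T)) (A : set T) : Prop :=
  exists C : set (set T),
    [/\ C `<=` F, trivIset C id & A = \bigcup_(B in C) B].

Section SmallGenerated.
Variables (R : realType) (X : topologicalType).

Definition small_loop (y : X) (b : {path (unit_itv R) from y to y}) : Prop :=
  forall V : set X, open V -> V y ->
    exists2 c : {path (unit_itv R) from y to y},
      path_homotopic b c & forall t, V (c t).

Definition pi1_small (y : X) : set (pi1 R y) :=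
  [set pi1_class b | b in @small_loop y].

Definition pi1_sg (x : X) : set (pi1 R x) :=
  generated_subgroup
    [set g | exists y (a : {path (unit_itv R) from x to y})
                      (b : {path (unit_itv R) from y to y}),
        pi1_small (pi1_class b) /\
        g = pi1_class (concat (concat a b) (reverse a))].

End SmallGenerated.

Arguments small_loop {R X y} b.
Arguments pi1_small R {X} y.
Arguments pi1_sg R {X} x.

(* Main.v *)
Require Import Defs.
From mathcomp Require Import all_boot all_order all_algebra.
From mathcomp Require Import all_classical all_reals.
From mathcomp Require Import topology.
From mathcomp Require Import normedtype homotopy.

(** In the quasitopological group [pi1 R x], an open or closed set is invariant
    under both translations by the elements of the closure [N] of [1], and [N] is
    a subgroup.  A small loop can be deformed into every neighbourhood of the
    constant loop, so by continuity of [c |-> [a * c * a^-1]] each generator of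
    [pi1_sg] lies in every neighbourhood of [1].  Hence [pi1_sg] is contained in
    [N], and its closure equals [N]. *)

Set Implicit Arguments.
Unset Strict Implicit.
Unset Printing Implicit Defensive.

Import Order.TTheory GRing.Theory Num.Theory.
Import numFieldNormedType.Exports.

Local Open Scope classical_set_scope.

(** * Subgroups of an abstract group and unions of their cosets *)

Section Cosets.
Variable G : groupType.
Local Open Scope group_scope.
Implicit Types H A : set G.

Lemma group_closed_memP H : group_closed (mem H) <->
  H 1 /\ (forall u v, H u -> H v -> H (u * v^-1)).
Proof.
split=> [[H1 HV]|[H1 HV]].
  split=> [|u v Hu Hv]; first exact: (set_mem H1).
  by apply: set_mem; apply: HV; exact: mem_set.
by split=> [|u v /set_mem Hu /set_mem Hv]; apply: mem_set => //; exact: HV.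
Qed.

Lemma group_closed_mem H : group_closed (mem H) ->
  [/\ H 1, forall u, H u -> H u^-1 & forall u v, H u -> H v -> H (u * v)].
Proof.
move=> /group_closed_memP[H1 HD].
have HV u : H u -> H u^-1 by move=> Hu; rewrite -(mul1g u^-1); exact: HD.
split=> // u v Hu Hv; rewrite -(invgK v).
by apply: HD => //; exact: HV.
Qed.

(** The cosets [g * H] with [g] in [A] work: invariance keeps them inside [A], [1] in [H] makes them
    cover it, and two that meet have representatives differing by an element of [H], hence
    coincide. *)
Lemma disjoint_union_left_cosets H A : group_closed (mem H) ->
  (forall g h, H h -> A g -> A (g * h)) -> disjoint_union_of (left_cosets H) A.
Proof.
move=> /group_closed_mem[H1 HV HM] AH.
exists [set [set g * h | h in H] | g in A]; split.
- by move=> _ [g _ <-]; exists g.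
- move=> _ _ [g _ <-] [g' _ <-] [_ [[h Hh <-] [h' Hh' e]]].
  have ge : g = g' * (h' * h^-1) by rewrite mulgA e mulgK.
  have ge' : g' = g * (h * h'^-1) by rewrite mulgA -e mulgK.
  apply/seteqP; split=> _ [k Hk <-].
    exists (h' * h^-1 * k); last by rewrite mulgA -ge.
    by do 2?apply: (HM) => //; exact: HV.
  exists (h * h'^-1 * k); last by rewrite mulgA -ge'.
  by do 2?apply: (HM) => //; exact: HV.
- apply/seteqP; split=> [g Ag|_ [_ [g Ag <-] [h Hh <-]]]; last exact: AH.
  by exists [set g * h | h in H]; [exists g|exists 1; rewrite ?mulg1].
Qed.

Lemma disjoint_union_right_cosets H A : group_closed (mem H) ->
  (forall g h, H h -> A g -> A (h * g)) -> disjoint_union_of (right_cosets H) A.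
Proof.
move=> /group_closed_mem[H1 HV HM] AH.
exists [set [set h * g | h in H] | g in A]; split.
- by move=> _ [g _ <-]; exists g.
- move=> _ _ [g _ <-] [g' _ <-] [_ [[h Hh <-] [h' Hh' e]]].
  have ge : g = h^-1 * h' * g' by rewrite -mulgA e mulKg.
  have ge' : g' = h'^-1 * h * g by rewrite -mulgA -e mulKg.
  apply/seteqP; split=> _ [k Hk <-].
    exists (k * (h^-1 * h')); last by rewrite -mulgA -ge.
    by do 2?apply: (HM) => //; exact: HV.
  exists (k * (h'^-1 * h)); last by rewrite -mulgA -ge'.
  by do 2?apply: (HM) => //; exact: HV.
- apply/seteqP; split=> [g Ag|_ [_ [g Ag <-] [h Hh <-]]]; last exact: AH.
  by exists [set h * g | h in H]; [exists g|exists 1; rewrite ?mul1g].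
Qed.

Lemma generated_subgroup_closed (S : set G) :
  group_closed (mem (generated_subgroup S)).
Proof.
apply/group_closed_memP; split=> [K [/group_closed_memP[]]//|u v Su Sv K KS].
have [/group_closed_memP[_ KV] _] := KS.
by apply: KV; [exact: Su|exact: Sv].
Qed.

End Cosets.

(** * Continuity of path operations in the compact-open topology *)

Section PathSpaces.
Variables (R : realType) (X : topologicalType).
Local Notation I := (unit_itv R).
Local Open Scope ring_scope.

Lemma unit_itv_compact : compact [set: I].
Proof.
have -> : [set: I] = @toI R @` `[0, 1]%classic.
  apply/seteqP; split=> // t _; exists (ofI t); last exact: ofIK.
  by rewrite /= in_itv /= ofI_ge0 ofI_le1.
apply: continuous_compact; last exact: segment_compact.
exact/continuous_subspaceT/toI_continuous.
Qed.

Lemma unit_itv_hausdorff : hausdorff_space I.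
Proof.
move=> s t st; apply/ofI_inj/(@norm_hausdorff _ R) => A B nA nB.
have [u [Au Bu]] := st _ _ (ofI_continuous nA) (ofI_continuous nB).
by exists (ofI u).
Qed.

Lemma unit_itv_locally_compact : locally_compact [set: I].
Proof.
move=> t _; rewrite withinET; exists setT; first exact: filterT.
by split; [exact: unit_itv_compact|exact: closedT].
Qed.

(** Uncurrying is legitimate because the interval is locally compact and Hausdorff. *)
Lemma path_eval_continuous (y z : X) :
  continuous (fun p : {path I from y to z} * I => p.1 p.2).
Proof.
rewrite (_ : (fun _ => _) =
    uncurry (fun c : {path I from y to z} => c : I -> X)).
  apply: continuous_uncurry.
  - exact: unit_itv_locally_compact.
  - exact: unit_itv_hausdorff.
  - exact: initial_continuous.
  - by move=> c; exact: cts_fun.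
by apply/funext => -[].
Qed.

(** Currying reduces continuity into a path space to continuity on [T * I], where gluing applies. *)
Lemma path_map_continuous (T : topologicalType) (y z : X)
    (F : T -> {path I from y to z}) :
  continuous (fun p : T * I => F p.1 p.2) -> continuous F.
Proof.
by move=> cF; apply: continuous_comp_initial; exact: continuous_curry_fun cF.
Qed.

Lemma path_eval_cts (T : topologicalType) (y z : X)
    (F : T -> {path I from y to z}) (s : T -> I) :
  continuous F -> continuous s -> continuous (fun t => F t (s t)).
Proof.
move=> cF cs.
apply: (@comp_cts _ _ _ (fun t => (F t, s t)) _ (@path_eval_continuous y z)).
exact: pair_cts.
Qed.

Lemma concat_continuous (T : topologicalType) (x y z : X)
    (F : T -> {path I from x to y}) (G : T -> {path I from y to z}) :
  continuous F -> continuous G -> continuous (fun t => concat (F t) (G t)).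
Proof.
move=> cF cG; apply: path_map_continuous; apply: glue_continuous.
- by cts.
- by apply: path_eval_cts; [apply: (comp_cts cF)|]; cts.
- by apply: path_eval_cts; [apply: (comp_cts cG)|]; cts.
- move=> t ->; rewrite divff ?pnatr_eq0 // subrr.
  by rewrite path_one path_zero.
Qed.

Lemma reverse_continuous (x y : X) :
  continuous (fun c : {path I from x to y} => reverse c).
Proof.
apply: path_map_continuous.
by apply: (path_eval_cts (@fst_cts _ _)); cts.
Qed.

(** The sets of maps with values in a given open [V] around [y] generate a filter [F]; the point is
    that [F] converges to the constant path. *)
Lemma nbhs_cst_path (y : X) (W : set {path I from y to y}) :
  nbhs (cst_path R y) W ->
  exists V, [/\ open V, V y &
    forall c : {path I from y to y}, (forall t, V (c t)) -> W c].
Proof.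
pose F := filter_from [set V : set X | open V /\ V y]
  (fun V => [set f : {compact-open, I -> X} | forall t, V (f t)]).
have FF : Filter F.
  apply: filter_from_filter; first by exists setT; split => //; exact: openT.
  move=> U V [oU Uy] [oV Vy]; exists (U `&` V); first by split; [exact: openI|].
  by move=> f UVf; split=> t; case: (UVf t).
have Fcst : F --> (cst_path R y : {compact-open, I -> X}).
  apply/compact_open_cvgP => K O _ oO KO.
  (* For [K] nonempty, [O] contains [y] and serves as [V]; for [K] empty, [O] may miss [y], but the
     condition on [f] is vacuous. *)
  have [[t Kt]|K0] := pselect (K !=set0).
    exists O; first by split => //; apply: KO; exists t.
    by move=> f Of /= _ [s _ <-]; exact: Of.
  exists setT; first by split => //; exact: openT.
  by move=> f _ z [s Ks _]; case: K0; exists s.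
(* Path spaces carry the initial topology, so an open [W1] is the preimage of an open set [W2] of
   maps. *)
rewrite nbhsE => -[W1 [[W2 oW2 <-] W2y] W1W].
have [V [oV Vy] VW] := Fcst _ (open_nbhs_nbhs (conj oW2 W2y)).
by exists V; split=> // c Vc; apply: W1W; exact: VW.
Qed.

End PathSpaces.

(** * Translations, inversion and the closure of [1] in the fundamental group *)

Section QuasitopologicalGroup.
Variables (R : realType) (X : topologicalType) (x : X).
Local Notation I := (unit_itv R).
Local Notation pi1 := (pi1 R x).
Local Open Scope group_scope.

Lemma pi1_class_continuous : continuous (@pi1_class R X x).
Proof. exact: pi_continuous. Qed.

Lemma pi1_continuous (T : topologicalType) (f : pi1 -> T) :
  continuous (fun c => f (pi1_class c)) -> continuous f.
Proof. by move=> cf; apply/quotient_continuous. Qed.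

(** One factor is fixed because a product of two quotient maps need not be a quotient map; the
    universal property handles one variable at a time. *)
Lemma pi1_mull_continuous (a : pi1) : continuous (fun b : pi1 => a * b).
Proof.
rewrite -(pi1_reprK a); apply: pi1_continuous.
rewrite (_ : (fun _ => _) = fun c => pi1_class (concat (pi1_repr a) c)).
  apply: (comp_cts pi1_class_continuous).
  by apply: concat_continuous; cts.
by apply/funext => c; exact: pi1_mulE.
Qed.

Lemma pi1_invg_continuous : continuous (fun a : pi1 => a^-1).
Proof.
apply: pi1_continuous.
rewrite (_ : (fun _ => _) = fun c => pi1_class (reverse c)).
  by apply: (comp_cts pi1_class_continuous); exact: reverse_continuous.
by apply/funext => c; exact: pi1_invE.
Qed.

Lemma open_pi1_mull (a : pi1) (U : set pi1) :
  open U -> open [set b : pi1 | U (a * b)].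
Proof. by move/continuousP: (@pi1_mull_continuous a); exact. Qed.

Lemma open_pi1_inv (U : set pi1) : open U -> open [set b : pi1 | U b^-1].
Proof. by move/continuousP: pi1_invg_continuous; exact. Qed.

Local Notation N := (closure [set (1 : pi1)]).

Lemma closure1P (s : pi1) : N s <-> forall U, open U -> U s -> U 1.
Proof.
split=> [Ns U oU Us|NU B].
  by have [_ [-> ]] := Ns _ (open_nbhs_nbhs (conj oU Us)).
by rewrite nbhsE => -[U [oU Us] UB]; exists 1; split=> //; apply: UB; exact: NU.
Qed.

Lemma closure1V (s : pi1) : N s -> N s^-1.
Proof.
move=> /closure1P Ns; apply/closure1P => U oU Us.
by rewrite -invg1; exact: (Ns _ (open_pi1_inv oU)).
Qed.

(** The open set of all [b] with [U (h * b)] contains [t] in [N], hence [1], which gives [U h]. *)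
Lemma open_mulr_closure1 (U : set pi1) (g s : pi1) :
  open U -> N s -> U (g * s) <-> U g.
Proof.
have half (h t : pi1) : open U -> N t -> U (h * t) -> U h.
  move=> oU /closure1P Nt Uht.
  by rewrite -(mulg1 h); exact: (Nt _ (open_pi1_mull h oU)).
move=> oU Ns; split; first exact: half.
(* The converse is the same implication for [g * s] and [s^-1]. *)
by rewrite -{1}(mulgK s g); apply: half => //; exact: closure1V.
Qed.

(** An equivalence passes to complements, which settles the closed case. *)
Lemma mulr_closure1 (A : set pi1) (g s : pi1) :
  open A \/ closed A -> N s -> A (g * s) <-> A g.
Proof.
move=> [oA|cA] Ns; first exact: open_mulr_closure1.
have := open_mulr_closure1 g (closed_openC cA) Ns => -[h1 h2].
by split=> Ag; apply: contrapT => ?; [exact: h2|exact: h1].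
Qed.

(** Inversion exchanges the two sides: [A] is replaced by the set of inverses of its elements, again
    open or closed. *)
Lemma mull_closure1 (A : set pi1) (g s : pi1) :
  open A \/ closed A -> N s -> A (s * g) <-> A g.
Proof.
move=> A_oc Ns.
have Ai : open [set b : pi1 | A b^-1] \/ closed [set b : pi1 | A b^-1].
  case: A_oc => [oA|cA]; [left; exact: open_pi1_inv|right].
  by move/continuous_closedP: pi1_invg_continuous; exact.
have := mulr_closure1 g^-1 Ai (closure1V Ns).
by rewrite /= invgM !invgK.
Qed.

Lemma closure1_group_closed : group_closed (mem N).
Proof.
apply/group_closed_memP; split=> [|u v /closure1P Nu Nv].
  exact: subset_closure.
apply/closure1P => U oU Uuv; apply: Nu => //.
exact: (open_mulr_closure1 u oU (closure1V Nv)).1.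
Qed.

Lemma small_conj_open (y : X) (a : {path I from x to y})
    (b : {path I from y to y}) (U : set pi1) :
  small_loop b -> open U -> U 1 ->
  U (pi1_class (concat (concat a b) (reverse a))).
Proof.
move=> sb oU U1.
pose conj_class c := pi1_class (concat (concat a c) (reverse a)).
have cc : continuous conj_class.
  apply: (comp_cts pi1_class_continuous).
  by do !apply: concat_continuous; cts.
have cst1 : conj_class (cst_path R y) = 1.
  apply/pi1_classP.
  apply: path_homotopic_trans (concat_reverse_r a).
  apply: path_homotopic_concat; first exact: concat_cst_r.
  exact: path_homotopic_refl.
have [|V [oV Vy VU]] := @nbhs_cst_path R X y (conj_class @^-1` U).
  by apply: cc; rewrite cst1; exact: open_nbhs_nbhs.
(* [conj_class] depends only on the homotopy class, so [b] may be replaced by a loop [c] inside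
   [V]. *)
have [c bc Vc] := sb V oV Vy.
suff -> : pi1_class (concat (concat a b) (reverse a)) = conj_class c.
  exact: VU.
apply/pi1_classP; do 2?apply: path_homotopic_concat => //;
  exact: path_homotopic_refl.
Qed.

(** Generators suffice, [N] being a subgroup. [small_conj_open] puts them in every neighbourhood of
    [1], while [N] asks for [1] in every neighbourhood of theirs; inversion followed by translation
    swaps the two. *)
Lemma pi1_sg_sub_closure1 : pi1_sg R x `<=` N.
Proof.
apply: smallest_sub; first exact: closure1_group_closed.
move=> _ [y [a [b [[b' sb' bb'] ->]]]]; apply/closure1P => U oU.
set s := pi1_class _ => Us.
(* The loop [b] is only known to share its class with a small loop [b']. *)
have e : s = pi1_class (concat (concat a b') (reverse a)).
  move/pi1_classP: bb' => bb'; apply/pi1_classP.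
  apply: path_homotopic_concat; last exact: path_homotopic_refl.
  apply: path_homotopic_concat; first exact: path_homotopic_refl.
  exact: path_homotopic_sym.
(* The open set [{t | s t^-1 \in U}] contains [1], hence [s]. *)
have := small_conj_open a sb' (open_pi1_inv (open_pi1_mull s oU)).
by rewrite -e /= invg1 mulg1 mulgV; exact.
Qed.

(** [pi1_sg] lies between the singleton of [1] and the closed set [N]. *)
Lemma closure_pi1_sg : closure (pi1_sg R x) = N.
Proof.
apply/seteqP; split.
  rewrite [X in _ `<=` X](closure_id _).1; last exact: closed_closure.
  exact/closure_subset/pi1_sg_sub_closure1.
apply: closure_subset => _ ->.
exact: ((group_closed_memP _).1 (generated_subgroup_closed _)).1.
Qed.

End QuasitopologicalGroup.

Theorem corollary2p4 (R : realType) (X : topologicalType) (x : X)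
    (A : set (pi1 R x)) (A_neq0 : A !=set0) (A_oc : open A \/ closed A) :
  [/\ disjoint_union_of (left_cosets (pi1_sg R x)) A,
      disjoint_union_of (right_cosets (pi1_sg R x)) A,
      disjoint_union_of (left_cosets (closure (pi1_sg R x))) A &
      disjoint_union_of (right_cosets (closure (pi1_sg R x))) A].
Proof.
have sg_group : group_closed (mem (pi1_sg R x)).
  exact: generated_subgroup_closed.
(* Both subgroups now lie in [N], so invariance of [A] under [N] yields all four decompositions. *)
rewrite closure_pi1_sg; have N_group := @closure1_group_closed R X x.
split.
- apply: disjoint_union_left_cosets => // g s /pi1_sg_sub_closure1 Ns Ag.
  exact/mulr_closure1.
- apply: disjoint_union_right_cosets => // g s /pi1_sg_sub_closure1 Ns Ag.
  exact/mull_closure1.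
- apply: disjoint_union_left_cosets => // g s Ns Ag.
  exact/mulr_closure1.
- apply: disjoint_union_right_cosets => // g s Ns Ag.
  exact/mull_closure1.
Qed.
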